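(* Let $\gamma(n)=o\left(\sqrt{n/\ln n}\right)$. There is no algorithm that, for every instance of the uniform Submodular Sparsest Cut problem on $n$ elements, makes only a polynomial (in $n$) number of value-oracle queries and with high probability outputs a solution whose objective value is within a factor $\gamma(n)$ of optimal. Likewise, for any constant balance parameter $b=\Theta(1)$, $0<b\le 1/2$, there is no such $\gamma(n)$-approximation algorithm for the unweighted Submodular $b$-Balanced Cut problem. Both statements hold even when the input functions are restricted to be symmetric (i.e. $f(S)=f(V\setminus S)$ for all $S$).
   Context: A function $f:2^V\to\mathbb{R}_{\ge 0}$ on an $n$-element ground set $V$ is submodular if $f(S)+f(T)\ge f(S\cup T)+f(S\cap T)$ for all $S,T\subseteq V$. The function is accessible only through a value oracle which, given $S\subseteq V$, returns $f(S)$. Uniform Submodular Sparsest Cut: given a nonnegative submodular $f$ on $V$, find $S\subseteq V$ (with $\emptyset\ne S\ne V$) minimizing $f(S)/(|S|\cdot|V\setminus S|)$. Unweighted Submodular $b$-Balanced Cut: given nonnegative submodular $f$ on $V$, a cut $(S,V\setminus S)$ is $b$-balanced if $|S|\ge bn$ and $|V\setminus S|\ge bn$; the goal is to find a $b$-balanced $S$ minimizing $f(S)$. An algorithm's output is a set $S$ together with the value of the objective on $S$. A $\gamma$-approximate solution is a feasible solution whose objective value is at most $\gamma$ times the optimum. *)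

(* Defs.v *)
From HB Require Import structures.
From mathcomp Require Import all_boot all_order all_algebra.
From mathcomp Require Import all_classical all_reals all_analysis.
Set Implicit Arguments.
Unset Strict Implicit.
Unset Printing Implicit Defensive.
Import Order.TTheory GRing.Theory Num.Theory.
Import numFieldNormedType.Exports.
Local Open Scope classical_set_scope.
Local Open Scope ring_scope.

Section SetFunctions.
Variables (R : realType) (n : nat).
Implicit Type f : {set 'I_n} -> R.

Definition submodular f : Prop :=
  forall S T : {set 'I_n}, f (S :|: T) + f (S :&: T) <= f S + f T.

Definition nonneg_submodular f : Prop := (forall S, 0 <= f S) /\ submodular f.

Definition symmetric_setfun f : Prop := forall S : {set 'I_n}, f S = f (~: S).

Definition nonneg_symmetric_submodular f : Prop :=
  nonneg_submodular f /\ symmetric_setfun f.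

End SetFunctions.

Section CutProblems.
Variables (R : realType) (n : nat).

Record cut_problem := CutProblem {
  feasible : pred {set 'I_n};
  objective : ({set 'I_n} -> R) -> {set 'I_n} -> R }.

Definition sparsest_cut : cut_problem := {|
  feasible := fun S => (S != finset.set0) && (S != finset.setT);
  objective := fun f S => f S / (#|S| * #|~: S|)%:R |}.

Definition balanced_cut (b : R) : cut_problem := {|
  feasible := fun S => (b * n%:R <= #|S|%:R) && (b * n%:R <= #|~: S|%:R);
  objective := fun f S => f S |}.

(* The infimum is over a finite set, hence a minimum as soon as some cut is
   feasible. *)
Definition optimum (Q : cut_problem) (f : {set 'I_n} -> R) : R :=
  inf [set objective Q f S | S in [set S | feasible Q S]].

(* An output pairs a set with its claimed objective value, which has to be the
   true one. *)
Definition approx_output (Q : cut_problem) (g : R) (f : {set 'I_n} -> R)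
    (o : {set 'I_n} * R) : Prop :=
  [/\ feasible Q o.1, o.2 = objective Q f o.1
    & objective Q f o.1 <= g * optimum Q f].

End CutProblems.

Section Algorithms.
Variables (R : realType) (n : nat).

(* A deterministic adaptive algorithm with access to a value oracle, as a
   decision tree branching on the oracle's answers; computation other than
   oracle queries is unrestricted. *)
Inductive query_tree :=
  | Output of {set 'I_n} & R
  | Query of {set 'I_n} & (R -> query_tree).

Fixpoint run (t : query_tree) (f : {set 'I_n} -> R) : {set 'I_n} * R :=
  match t with
  | Output X v => (X, v)
  | Query X k => run (k (f X)) f
  end.

Fixpoint query_count (t : query_tree) (f : {set 'I_n} -> R) : nat :=
  match t with
  | Output _ _ => 0%N
  | Query X k => (query_count (k (f X)) f).+1
  end.

(* A randomized algorithm: a random decision tree over an arbitrary probability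
   space, whose output on each oracle is a random variable (the set component
   ranges over a finite type). *)
Record rand_alg := RandAlg {
  seed_display : measure_display;
  seed : measurableType seed_display;
  seed_law : probability seed R;
  tree : seed -> query_tree;
  run_measurable : forall (f : {set 'I_n} -> R) (S : {set 'I_n}) (v : R),
    measurable [set w | run (tree w) f = (S, v)] }.

End Algorithms.

(* "With high probability" is: with probability at least p n, where p n tends
   to 1. Ground sets admitting no feasible cut (e.g. odd n when b = 1/2) carry
   no success requirement. *)
Definition approximable (R : realType)
    (cls : forall n, ({set 'I_n} -> R) -> Prop)
    (Q : forall n, cut_problem R n) (gamma : nat -> R) : Prop :=
  exists (A : forall n, rand_alg R n) (q : {poly nat}) (p : nat -> R),
    [/\ p @ \oo --> (1 : R),
        forall n (f : {set 'I_n} -> R) (w : seed (A n)),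
          cls n f -> (query_count (tree w) f <= q.[n])%N
      & forall n (f : {set 'I_n} -> R),
          cls n f -> (exists S, feasible (Q n) S) ->
          ((p n)%:E <= seed_law (A n)
             [set w | approx_output (Q n) (gamma n) f (run (tree w) f)])%E].

(* Main.v *)
(** On n = 2m elements, an algorithm cannot tell the instance min(|S|, |~: S|)
    from one in which a random bisection A has been hidden, so that its value
    at A drops from m to beta, about sqrt(n ln n), while the value at S only
    changes if |S :&: A| and |S :\: A| differ by more than beta.  If A picks one
    element of each of m fixed pairs, that difference is a sum of m independent
    signs, so a fixed query detects A with probability at most 2 n^-D, where D
    can be taken larger than the degree of the query bound.  Averaging over A
    and the seed, some hidden instance gets the same output as the blind one
    on most seeds, yet their optima are a factor of order sqrt(n / ln n) apart. *)

Require Import Defs.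
From HB Require Import structures.
From mathcomp Require Import all_boot all_order all_algebra.
From mathcomp Require Import all_classical all_reals all_analysis.
From mathcomp Require Import measurable_realfun lra ring zify.
Import Order.TTheory GRing.Theory Num.Theory.
Import numFieldNormedType.Exports.
Set Implicit Arguments.
Unset Strict Implicit.
Unset Printing Implicit Defensive.
Local Open Scope classical_set_scope.
Local Open Scope ring_scope.

(** * Truncations of monotone submodular functions *)

Section Submodularity.
Variables (R : realType) (n : nat).
Implicit Types (f g h : {set 'I_n} -> R) (A S T : {set 'I_n}).

Definition monotone_setfun h := forall S T, S \subset T -> h S <= h T.

Lemma cardI_mono A : monotone_setfun (fun S => #|S :&: A|%:R).
Proof. by move=> S T ST; rewrite ler_nat subset_leq_card// finset.setSI. Qed.

Lemma cardI_modular A S T :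
  #|(S :|: T) :&: A|%:R + #|(S :&: T) :&: A|%:R
    = #|S :&: A|%:R + #|T :&: A|%:R :> R.
Proof.
rewrite -!natrD; congr (_%:R).
by rewrite finset.setIUl finset.setIIl cardsUI.
Qed.

Lemma trunc_mono h c : monotone_setfun h ->
  monotone_setfun (fun S => Num.min (h S) c).
Proof. by move=> hm S T /hm; rewrite !minEle; do 2 case: ifP; lra. Qed.

(** If [h S] or [h T] reaches [c], so does [h (S :|: T)], and monotonicity bounds the intersection
    term by the other truncated value. Otherwise only the union can be cut, which lowers the left
    side. *)
Lemma trunc_submodular h c : monotone_setfun h -> submodular h ->
  submodular (fun S => Num.min (h S) c).
Proof.
move=> hm hs S T.
have := hm _ _ (finset.subsetUl S T); have := hm _ _ (finset.subsetUr S T).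
have := hm _ _ (finset.subsetIl S T); have := hm _ _ (finset.subsetIr S T).
by have := hs S T; rewrite !minEle; do 4 case: ifP; lra.
Qed.

Lemma add_submodular f g : submodular f -> submodular g ->
  submodular (fun S => f S + g S).
Proof. by move=> hf hg S T; have := hf S T; have := hg S T; lra. Qed.

End Submodularity.

(** * The blind instance and the hidden-bisection instances *)

Section HardInstances.
Variables (R : realType) (m : nat).
Local Notation n := (m + m)%N.
Implicit Types (A S T : {set 'I_n}) (beta : R).

(** This is min(|S|, |~: S|), written as a truncation minus a modular term so that submodularity
    follows from truncation and the comparison with [hidden_cut] is direct. *)
Definition blind_cut S : R := 2 * Num.min #|S|%:R m%:R - #|S|%:R.

(* Capping both sides at k is what lowers the value at A and at ~: A, and it
   keeps the function symmetric. *)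
Definition hidden_cut beta A S : R :=
  let k := (m%:R + beta) / 2 in
  2 * Num.min (Num.min #|S :&: A|%:R k + Num.min #|S :&: ~: A|%:R k) m%:R
  - #|S|%:R.

Lemma cardsICE A S : #|S|%:R = #|S :&: A|%:R + #|S :&: ~: A|%:R :> R.
Proof. by rewrite -natrD -finset.setDE cardsID. Qed.

Lemma cardIsC A S : #|S :&: A|%:R + #|~: S :&: A|%:R = #|A|%:R :> R.
Proof.
by rewrite -natrD (finset.setIC S) (finset.setIC (~: S)) -finset.setDE cardsID.
Qed.

Lemma card_halfC A : #|A| = m -> #|~: A| = m.
Proof. by move=> cA; have := cardsC A; rewrite cA card_ord; lia. Qed.

Lemma truncated_submodular (h : {set 'I_n} -> R) :
  monotone_setfun h -> submodular h ->
  submodular (fun S => 2 * Num.min (h S) m%:R - #|S|%:R).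
Proof.
move=> hm hs S T; have := trunc_submodular m%:R hm hs S T.
have := cardI_modular R [set: 'I_n] S T; rewrite !finset.setIT.
by lra.
Qed.

Lemma blind_cutE S : blind_cut S = Num.min #|S|%:R #|~: S|%:R.
Proof.
have : #|S|%:R + #|~: S|%:R = m%:R + m%:R :> R.
  by rewrite -!natrD cardsC card_ord.
by rewrite /blind_cut !minEle; do 2 case: ifP; lra.
Qed.

Lemma blind_cut_nss : nonneg_symmetric_submodular blind_cut.
Proof.
split; [split|].
- by move=> S; rewrite blind_cutE le_min !ler0n.
- apply: truncated_submodular => [S T ST|S T].
    by rewrite ler_nat subset_leq_card.
  have := cardI_modular R [set: 'I_n] S T; rewrite !finset.setIT; lra.
- by move=> S; rewrite !blind_cutE finset.setCK minC.
Qed.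

(** Nonnegativity rests on 2k >= m, for k the cap, and on both traces of S having at most m
    elements. Complementation turns traces x, y into m - x, m - y, so symmetry is a linear case
    analysis. *)
Lemma hidden_cut_nss beta A : 0 <= beta -> #|A| = m ->
  nonneg_symmetric_submodular (hidden_cut beta A).
Proof.
move=> b0 cA; have cA' := card_halfC cA.
have bnd S : [/\ #|S :&: A|%:R <= m%:R :> R & #|S :&: ~: A|%:R <= m%:R :> R].
  split; rewrite ler_nat; [rewrite -[leqRHS]cA|rewrite -[leqRHS]cA'];
  by rewrite subset_leq_card// finset.subsetIr.
split; [split|].
- move=> S; rewrite /hidden_cut (cardsICE A S); have [] := bnd S.
  have : 0 <= #|S :&: A|%:R :> R by [].
  have : 0 <= #|S :&: ~: A|%:R :> R by [].
  by rewrite !minEle; do 3 case: ifP; lra.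
- apply: truncated_submodular.
    move=> S T ST; apply: lerD.
      exact: trunc_mono (cardI_mono R A) _ _ ST.
    exact: trunc_mono (cardI_mono R (~: A)) _ _ ST.
  by apply: add_submodular; apply: trunc_submodular;
    [exact: cardI_mono|move=> S T; rewrite cardI_modular|
     exact: cardI_mono|move=> S T; rewrite cardI_modular].
- move=> S; rewrite /hidden_cut (cardsICE A S) (cardsICE A (~: S)).
  have := cardIsC A S; have := cardIsC (~: A) S; rewrite cA cA'.
  have [] := bnd S.
  have : 0 <= #|S :&: A|%:R :> R by [].
  have : 0 <= #|S :&: ~: A|%:R :> R by [].
  rewrite !minEle; do 6 case: ifP; lra.
Qed.

Lemma hidden_cut_le beta A : 0 <= beta -> #|A| = m -> hidden_cut beta A A <= beta.
Proof.
move=> b0 cA; rewrite /hidden_cut finset.setIid finset.setICr cards0 cA.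
have : 0 <= m%:R :> R by [].
by rewrite !minEle; do 3 case: ifP; lra.
Qed.

(** If one trace exceeds the cap k = (m + beta) / 2, the other is at least k - beta = m - k. Both
    the capped and the uncapped sum then reach m, so the outer minimum hides the inner cap. *)
Lemma hidden_cut_eq_blind beta A S : 0 <= beta -> #|A| = m ->
  `| #|S :&: A|%:R - #|S :&: ~: A|%:R | <= beta ->
  hidden_cut beta A S = blind_cut S.
Proof.
move=> b0 cA; rewrite ler_norml => /andP[]; rewrite /hidden_cut /blind_cut.
rewrite (cardsICE A S) !minEle; do 4 case: ifP; lra.
Qed.

End HardInstances.

(** * A tail bound for weighted sums of signs *)

Section Chernoff.
Variables (R : realType) (m : nat).
Implicit Types (a : 'I_m -> R) (e : {ffun 'I_m -> bool}).

Definition sgb (b : bool) : R := if b then 1 else -1.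

(** After inversion, exp(x) >= 1 + x reduces this to (1 + u)(1 - u + 2u^2) = 1 + u^2 (1 + 2u) >=
    1. *)
Lemma expR_quad_le (u : R) : `|u| <= 1 / 2 -> expR (u - 2 * u ^+ 2) <= 1 + u.
Proof.
rewrite ler_norml => /andP[u1 u2].
rewrite -[u - _]opprK expRN -[leRHS]invrK lef_pV2 ?posrE ?expR_gt0 ?invr_gt0; try lra.
apply: le_trans (expR_ge1Dx _).
rewrite -[leLHS]mul1r ler_pdivrMr; last lra.
have : 0 <= u ^+ 2 * (1 + 2 * u) by apply: mulr_ge0; [exact: sqr_ge0|lra].
by rewrite !expr2; nra.
Qed.

Lemma sum_prod_signs a (t : R) :
  \sum_(e : {ffun 'I_m -> bool}) \prod_i (1 + t * (sgb (e i) * a i)) = 2 ^+ m.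
Proof.
rewrite -(bigA_distr_bigA (fun i b => 1 + t * (sgb b * a i))).
rewrite (eq_bigr (fun=> 2)); first by rewrite prodr_const card_ord.
by move=> i _; rewrite big_bool /sgb /=; ring.
Qed.

(** A Chernoff argument in which the product of the 1 + t z_i replaces the exponential moment: its
    total over all signs is exactly 2^m, and it dominates exp(t X - 2 t^2 m), where X is the sum of
    the z_i. *)
Lemma sign_tail a (beta : R) : (forall i, `|a i| <= 1) -> 0 <= beta ->
  (0 < m)%N ->
  #|[set e : {ffun 'I_m -> bool} | beta < \sum_i sgb (e i) * a i]%SET|%:R
    <= 2 ^+ m * expR (- (beta ^+ 2 / (8 * m%:R))).
Proof.
move=> a1 b0 m0; have mR : 0 < m%:R :> R by rewrite ltr0n.
have s1 e i : `|sgb (e i) * a i| <= 1.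
  by rewrite normrM /sgb; case: (e i); rewrite ?normrN normr1 mul1r.
(* For [beta > m] the event is empty, since m terms of absolute value at most 1 cannot sum beyond
   m. *)
have [bm|mb] := leP beta m%:R; last first.
  rewrite (_ : [set e | _]%SET = finset.set0) ?cards0.
    by rewrite mulr_ge0 ?exprn_ge0 ?expR_ge0.
  apply/setP => e; rewrite !inE; apply/negbTE; rewrite -leNgt.
  apply: le_trans (ltW mb); apply: le_trans (ler_norm _) _.
  apply: le_trans (ler_norm_sum _ _ _) _.
  apply: le_trans (ler_sum _ (fun i _ => s1 e i)) _.
  by rewrite sumr_const card_ord.
(* This [t] maximises t beta - 2 t^2 m, with value beta^2 / (8m); [beta <= m] keeps it in the range
   of [expR_quad_le]. *)
pose t := beta / (4 * m%:R).
have t0 : 0 <= t by rewrite divr_ge0// mulr_ge0.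
have t1 : t <= 1 / 2 by rewrite ler_pdivrMr; lra.
have tE : 4 * m%:R * t = beta by rewrite /t mulrCA divff ?mulr1 ?gt_eqF//; lra.
have key e : expR (t * (\sum_i sgb (e i) * a i) - 2 * t ^+ 2 * m%:R)
    <= \prod_i (1 + t * (sgb (e i) * a i)).
  rewrite mulr_sumr -[m%:R](_ : \sum_(i < m) 1 = _); last first.
    by rewrite sumr_const card_ord.
  rewrite mulr_sumr -sumrB expR_sum; apply: ler_prod => i _.
  rewrite expR_ge0 /=; set z := sgb _ * _.
  have z1 : `|z| <= 1 by exact: s1.
  apply: le_trans (expR_quad_le _); last first.
    by rewrite normrM (ger0_norm t0); have := normr_ge0 z; nra.
  rewrite ler_expR mulr1 lerD2l lerN2 ler_pM2l// exprMn.
  by rewrite ler_piMr ?sqr_ge0// -real_normK ?num_real// expr_le1.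
rewrite expRN ler_pdivlMr ?expR_gt0// -(sum_prod_signs a t).
rewrite -sum1_card natr_sum mulr_suml.
(* Markov's inequality: the terms outside the event are nonnegative and are dropped. *)
rewrite [leRHS](bigID [in [set e : {ffun 'I_m -> bool} | beta < \sum_i sgb (e i) * a i]%SET]) /=.
rewrite -[leLHS]addr0; apply: lerD; last first.
  by apply: sumr_ge0 => e _; apply: le_trans (key e); exact: expR_ge0.
apply: ler_sum => e; rewrite inE => be; rewrite mul1r.
apply: le_trans (key e); rewrite ler_expR.
have -> : beta ^+ 2 / (8 * m%:R) = t * beta - 2 * t ^+ 2 * m%:R.
  by rewrite /t; field; rewrite gt_eqF.
by rewrite lerD2r ler_wpM2l// ltW.
Qed.

End Chernoff.

(** * Random bisections and their detection by a fixed query *)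

Section RandomHalf.
Variables (R : realType) (m : nat).
Local Notation n := (m + m)%N.
Implicit Types (S : {set 'I_n}) (e : {ffun 'I_m -> bool}).

(* Choosing one element of each pair {i, m + i} makes the trace on a fixed set
   a sum of independent signs. *)
Definition half_of e : {set 'I_n} :=
  [set j | match fintype.split j with inl i => e i | inr i => ~~ e i end]%SET.

Lemma in_half_lshift e i : (lshift m i \in half_of e) = e i.
Proof. by rewrite inE (unsplitK (inl i)). Qed.

Lemma in_half_rshift e i : (rshift m i \in half_of e) = ~~ e i.
Proof. by rewrite inE (unsplitK (inr i)). Qed.

Lemma cardE_split (A : {set 'I_n}) :
  #|A| = (\sum_(i < m) ((lshift m i \in A) + (rshift m i \in A)))%N.
Proof.
rewrite -sum1_card big_mkcond big_split_ord big_split /=.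
by congr (_ + _)%N; apply: eq_bigr => i _; case: (_ \in _).
Qed.

Lemma card_half e : #|half_of e| = m.
Proof.
rewrite cardE_split (eq_bigr (fun=> 1%N)) ?sum1_card ?card_ord// => i _.
by rewrite in_half_lshift in_half_rshift; case: (e i).
Qed.

Definition pair_weight S i : R := (lshift m i \in S)%:R - (rshift m i \in S)%:R.

Lemma half_discrepancy e S :
  #|S :&: half_of e|%:R - #|S :&: ~: half_of e|%:R
    = \sum_i sgb R (e i) * pair_weight S i.
Proof.
rewrite !cardE_split !natr_sum -sumrB; apply: eq_bigr => i _.
rewrite !finset.in_setI !finset.in_setC !in_half_lshift !in_half_rshift /pair_weight /sgb.
by case: (_ \in S); case: (_ \in S); case: (e i) => /=; ring.
Qed.

(** Detection forces the discrepancy out of [-beta, beta]. Each side is an instance of [sign_tail],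
    the lower one with negated weights, whence the factor 2. *)
Lemma card_distinguishing (beta : R) S : 0 <= beta -> (0 < m)%N ->
  #|[set e | hidden_cut beta (half_of e) S != blind_cut R S]%SET|%:R
    <= 2 * (2 ^+ m * expR (- (beta ^+ 2 / (8 * m%:R)))).
Proof.
move=> b0 m0; pose a := pair_weight S; pose a' i := - a i.
have a1 i : `|a i| <= 1.
  by rewrite /a /pair_weight; do 2 case: (_ \in S);
    rewrite ?subrr ?subr0 ?sub0r ?normrN ?normr0 ?normr1.
have a'1 i : `|a' i| <= 1 by rewrite normrN.
rewrite mulr2n mulrDl mul1r.
apply: le_trans (lerD (sign_tail a1 b0 m0) (sign_tail a'1 b0 m0)).
rewrite -natrD ler_nat; apply: leq_trans (leq_card_setU _ _).
apply/subset_leq_card/fintype.subsetP => e; rewrite !inE.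
apply: contraR; rewrite negb_or -!leNgt => /andP[u v].
apply/eqP/hidden_cut_eq_blind; rewrite ?card_half//.
rewrite half_discrepancy ler_norml u andbT lerNl -sumrN.
by apply: le_trans v; apply: ler_sum => i _; rewrite mulrN.
Qed.

End RandomHalf.

(** * Runs of query trees and measurability of success *)

Section QueryTrees.
Variables (R : realType) (n : nat).
Implicit Types (t : query_tree R n) (f g : {set 'I_n} -> R).

Fixpoint queries t f : seq {set 'I_n} :=
  match t with
  | Output _ _ => [::]
  | Query X k => X :: queries (k (f X)) f
  end.

Lemma size_queries t f : size (queries t f) = query_count t f.
Proof. by elim: t => //= X k ->. Qed.

(** Adaptivity does not help: equal answers to the queries made on [f] keep [g] on the same
    branch. *)
Lemma run_agree t f g : (forall S, S \in queries t f -> g S = f S) ->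
  run t g = run t f.
Proof.
elim: t => //= X k IH fg; rewrite fg ?mem_head//; apply: IH => S Sq.
by apply: fg; rewrite inE Sq orbT.
Qed.

(** A successful output is determined by its set, so success is a finite union of events covered by
    [run_measurable]. *)
Lemma measurable_success (A : rand_alg R n) (Q : cut_problem R n) (c : R) f :
  measurable [set w : seed A | approx_output Q c f (run (tree w) f)].
Proof.
rewrite (_ : mkset _ = \bigcup_(S in [set S | approx_output Q c f
    (S, objective Q f S)]) [set w | run (tree w) f = (S, objective Q f S)]).
  apply: fin_bigcup_measurable => [|S _]; last exact: run_measurable.
  exact: finite_finset.
apply/seteqP; split=> [w|w [S okS /= ->]//] /=.
case E: (run _ _) => [S v] ok; have [_ /= vE _] := ok.
by exists S; rewrite /= -vE ?E.
Qed.

End QueryTrees.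

(** * Probability estimates for families of events *)

Lemma sum_probability_le (R : realType) (d : measure_display)
    (T : measurableType d) (P : probability T R) (I : finType)
    (B : I -> set T) (K : R) : (forall i, measurable (B i)) ->
  (forall w, \sum_i \1_(B i) w <= K) -> (\sum_i P (B i) <= K%:E)%E.
Proof.
move=> mB BK.
(* The sum of the probabilities is the expected number of events that occur. *)
have -> : (\sum_i P (B i) = \int[P]_(w in setT) (\sum_i (\1_(B i) w)%:E))%E.
  rewrite ge0_integral_sum//.
  - by apply: eq_bigr => i _; rewrite integral_indic// setIT.
  - by move=> i; apply/measurable_EFinP; exact: measurable_indic.
have -> : (K%:E = \int[P]_(w in setT) (cst K%:E w))%E.
  rewrite integral_cst// -[LHS]mule1; congr (_ * _)%E.
  exact/esym/probability_setT.
apply: ge0_le_integral => //.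
- by move=> x _; apply: sume_ge0.
- by apply: emeasurable_sum => i; apply/measurable_EFinP; exact: measurable_indic.
- by move=> w _; rewrite sumEFin lee_fin.
Qed.

Lemma probabilityI_ge (R : realType) (d : measure_display)
    (T : measurableType d) (P : probability T R) (A B : set T) (p : R) :
  measurable A -> measurable B -> (p%:E <= P A)%E -> (p%:E <= P B)%E ->
  ((2 * p - 1)%:E <= P (A `&` B))%E.
Proof.
move=> mA mB pA pB.
have : (P A <= P (A `&` B) + P (~` B))%E.
  apply: le_trans (measureU2 _ _ _); [|exact: measurableI|exact: measurableC].
  apply: le_measure; rewrite ?inE//.
    by apply: measurableU; [exact: measurableI|exact: measurableC].
  by move=> x Ax; case: (pselect (B x)) => Bx; [left|right].
rewrite probability_setC//; move: pA pB.
rewrite -(fineK (fin_num_measure P A mA)) -(fineK (fin_num_measure P B mB)).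
rewrite -(fineK (fin_num_measure P _ (measurableI _ _ mA mB))).
rewrite -EFinB -EFinD !lee_fin; lra.
Qed.

(** * Objectives that are sensitive to a hidden bisection *)

Section Hardness.
Variable R : realType.

(* The value of the blind instance exceeds that of a hidden bisection A by a
   factor at least c * n / f A. *)
Record detects_bisections (Q : forall n, cut_problem R n) (c : R) : Prop := {
  bisection_feasible : forall m (A : {set 'I_(m + m)}),
    (0 < m)%N -> #|A| = m -> feasible (Q (m + m)%N) A;
  objective_ge0 : forall n (f : {set 'I_n} -> R) S,
    (forall S, 0 <= f S) -> 0 <= objective (Q n) f S;
  blind_objective_gt0 : forall m S, (0 < m)%N -> feasible (Q (m + m)%N) S ->
    0 < objective (Q (m + m)%N) (@blind_cut R m) S;
  bisection_gap : forall m (f : {set 'I_(m + m)} -> R) (A S : {set 'I_(m + m)}), (0 < m)%N -> #|A| = m ->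
    feasible (Q (m + m)%N) S -> (forall S, 0 <= f S) ->
    objective (Q (m + m)%N) f A * (c * (m + m)%:R)
      <= f A * objective (Q (m + m)%N) (@blind_cut R m) S }.

Lemma balanced_detects (b : R) : 0 < b -> b <= 1 / 2 ->
  detects_bisections (fun n => balanced_cut n b) b.
Proof.
move=> b0 b1; split => /=.
- move=> m A m0 cA; rewrite (card_halfC cA) cA natrD.
  by have : 0 < m%:R :> R; [rewrite ltr0n|nra].
- by move=> n f S ->.
- move=> m S m0 /andP[bS bS']; rewrite blind_cutE lt_min.
  have bm : 0 < b * (m + m)%:R by rewrite mulr_gt0// ltr0n addn_gt0 m0.
  by rewrite !(lt_le_trans bm).
- move=> m f A S m0 _ /andP[bS bS'] f0; apply: ler_wpM2l => //.
  by rewrite blind_cutE le_min bS.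
Qed.

(** The blind objective is 1 / max(|S|, |~: S|) >= 1/n, while a bisection has objective f(A) / m^2 =
    4 f(A) / n^2; this gives the constant 1/4. *)
Lemma sparsest_detects : detects_bisections (@sparsest_cut R) (1 / 4).
Proof.
have cards m (S : {set 'I_(m + m)}) : (S != finset.set0) && (S != finset.setT) ->
    [/\ 0 < #|S|%:R :> R, 0 < #|~: S|%:R :> R
      & #|S|%:R + #|~: S|%:R = (m + m)%:R :> R].
  move=> /andP[S0 ST]; rewrite !ltr0n !card_gt0 S0 -natrD cardsC card_ord.
  by split => //; apply: contra ST => /eqP SC; rewrite -[S]finset.setCK SC finset.setC0.
split => /=.
- move=> m A m0 cA; rewrite -card_gt0 cA m0 /=.
  apply/negP => /eqP AT; have := card_halfC cA.
  by rewrite AT finset.setCT cards0; lia.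
- by move=> n f S f0; apply: divr_ge0.
- move=> m S m0 /cards[S0 S1 _]; rewrite blind_cutE natrM.
  by rewrite divr_gt0 ?mulr_gt0// lt_min S0.
- move=> m f A S m0 cA /cards[S0 S1 SE] f0; rewrite (card_halfC cA) cA.
  rewrite -mulrA; apply: ler_wpM2l => //.
  have mR : 0 < m%:R :> R by rewrite ltr0n.
  rewrite !natrM blind_cutE.
  have -> : (m%:R * m%:R)^-1 * (1 / 4 * (m + m)%:R) = (m%:R + m%:R)^-1 :> R.
    by rewrite natrD; field; rewrite !gt_eqF//; lra.
  rewrite ler_pdivlMr ?mulr_gt0// mulrC ler_pdivrMr; last lra.
  move: SE; rewrite natrD => <-.
  by rewrite minEle; case: ifP => _; nra.
Qed.

(** * From the gap in objectives to a bound on the success probability *)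

Section Gap.
Variables (Q : forall n, cut_problem R n) (c : R) (m : nat).
Hypotheses (HQ : detects_bisections Q c) (m0 : (0 < m)%N).
Local Notation n := (m + m)%N.

(** The claimed value must be exact on both instances, so a shared output has one objective value v
    > 0. Near-optimality for the hidden instance gives v <= g x, with x its objective at [A], and
    the gap gives x c n <= beta v; hence c n v <= g beta v < c n v. *)
Lemma approx_outputs_disjoint (beta g : R) (A : {set 'I_n}) o : 0 <= beta ->
  #|A| = m -> g * beta < c * n%:R ->
  approx_output (Q n) g (@blind_cut R m) o ->
  ~ approx_output (Q n) g (hidden_cut beta A) o.
Proof.
move=> b0 cA gb [So oE _] [_ oE' ole].
have [[h0 _] _] := hidden_cut_nss b0 cA.
set v := objective (Q n) (@blind_cut R m) o.1.
have v0 : 0 < v by exact: (blind_objective_gt0 HQ).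
have lb : has_lbound [set objective (Q n) (hidden_cut beta A) S
    | S in [set S | feasible (Q n) S]].
  by exists 0 => _ [S _ <-]; exact: (objective_ge0 HQ).
have optle : optimum (Q n) (hidden_cut beta A)
    <= objective (Q n) (hidden_cut beta A) A.
  by apply: ge_inf => //; exists A => //=; exact: (bisection_feasible HQ).
have opt0 : 0 <= optimum (Q n) (hidden_cut beta A).
  apply: lb_le_inf; last by move=> _ [S _ <-]; exact: (objective_ge0 HQ).
  exists (objective (Q n) (hidden_cut beta A) A), A => //=.
  exact: (bisection_feasible HQ).
have vle : v <= g * optimum (Q n) (hidden_cut beta A) by rewrite /v -oE oE'.
(* A negative [g] would force [v <= 0]. *)
have [g0|g0] := leP 0 g; last first.
  by have := mulr_ge0 (ltW (etrans (oppr_gt0 g) g0)) opt0; lra.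
have gap := bisection_gap HQ m0 cA So h0.
have hA := hidden_cut_le b0 cA.
have fA0 := h0 A.
have n0 : 0 < n%:R :> R by rewrite ltr0n addn_gt0 m0.
rewrite -/v in gap.
move: gap vle optle opt0 hA fA0 gb v0.
move: (objective _ _ A) (optimum _ _) (hidden_cut _ _ _) (c * _).
move=> x y z k gap vle yx y0 zb z0 gb v0.
have v1 : v <= g * x by apply: le_trans vle _; exact: ler_wpM2l.
have k0 : 0 < k by apply: le_lt_trans gb; exact: mulr_ge0.
have : v * k <= g * x * k by rewrite ler_pM2r.
have : g * (x * k) <= g * (z * v) by exact: ler_wpM2l.
have : g * (z * v) <= g * (beta * v) by rewrite ler_wpM2l// ler_wpM2r// ltW.
have : g * beta * v < k * v by rewrite ltr_pM2r.
lra.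
Qed.

(** Double counting of pairs (seed, bisection) on which both instances are solved: few bisections
    per seed by a union bound over the blind queries, yet probability at least 2p - 1 per
    bisection. *)
Lemma success_probability_le (A : rand_alg R n) (beta g p : R) (q : nat) :
  0 <= beta -> g * beta < c * n%:R ->
  (forall w : seed A, (query_count (tree w) (@blind_cut R m) <= q)%N) ->
  (forall f, nonneg_symmetric_submodular f ->
     (p%:E <= seed_law A
       [set w | approx_output (Q n) g f (run (tree w) f)])%E) ->
  2 * p - 1 <= 2 * q%:R * expR (- (beta ^+ 2 / (8 * m%:R))).
Proof.
move=> b0 gb qA pA.
pose hid (e : {ffun 'I_m -> bool}) := hidden_cut beta (half_of e).
pose ok f := [set w : seed A | approx_output (Q n) g f (run (tree w) f)].
pose B e := ok (hid e) `&` ok (@blind_cut R m).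
have mok f : measurable (ok f) by exact: measurable_success.
set K := 2 * q%:R * _.
have : (\sum_e seed_law A (B e) <= (2 ^+ m * K)%:E)%E.
  apply: sum_probability_le => [e|w]; first exact: measurableI.
  have -> : \sum_e \1_(B e) w = #|[set e | w \in B e]%SET|%:R :> R.
    rewrite -sum1_card natr_sum [RHS]big_mkcond /=; apply: eq_bigr => e _.
    by rewrite indicE inE; case: (_ \in _).
  pose s := queries (tree w) (@blind_cut R m).
  pose D S := [set e | hid e S != blind_cut R S]%SET.
  (* If no blind query separates the instances, [run_agree] makes the outputs equal, which
     [approx_outputs_disjoint] forbids. *)
  have sub : [set e | w \in B e]%SET \subset \bigcup_(S <- s) D S.
    apply/fintype.subsetP => e; rewrite inE => /set_mem[oke ok0].
    apply: contra_notT (approx_outputs_disjoint b0 (card_half e) gb ok0) => eD.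
    rewrite -(run_agree (g := hid e))// => S Ss; apply/eqP/negPn.
    apply: contra eD => hS; rewrite (big_rem S Ss) /= inE.
    by rewrite [in X in X || _]inE hS.
  apply: (@le_trans _ _ (\sum_(S <- s) #|D S|%:R)).
    rewrite -natr_sum ler_nat; apply: leq_trans (subset_leq_card sub) _.
    elim: s {sub} => [|S s IH]; first by rewrite !big_nil cards0.
    rewrite !big_cons; apply: leq_trans (leq_card_setU _ _) _.
    by rewrite leq_add2l.
  apply: le_trans (ler_sum _ (fun S _ => card_distinguishing S b0 m0)) _.
  rewrite big_const_seq count_predT iter_addr_0 size_queries -[leLHS]mulr_natl.
  rewrite /K; set x := expR _.
  have -> : 2 ^+ m * (2 * q%:R * x) = q%:R * (2 * (2 ^+ m * x)) by ring.
  by rewrite ler_wpM2r ?ler_nat// !mulr_ge0 ?exprn_ge0 ?expR_ge0.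
have : (\sum_(e : {ffun 'I_m -> bool}) (2 * p - 1)%:E
    <= \sum_e seed_law A (B e))%E.
  apply: lee_sum => e _; apply: probabilityI_ge => //; apply: pA.
    by apply: hidden_cut_nss; rewrite ?card_half.
  exact: blind_cut_nss.
move=> /le_trans h /h; rewrite sumEFin lee_fin sumr_const card_ffun card_bool.
rewrite card_ord -[leLHS]mulr_natl natrX ler_pM2l// exprn_gt0//.
Qed.

End Gap.

(** * Asymptotics and choice of parameters *)

Lemma horner_nat_le (q : {poly nat}) (n : nat) : (0 < n)%N ->
  (q.[n] <= q.[1] * n ^ size q)%N.
Proof.
move=> n0; rewrite !horner_coef.
rewrite (_ : \sum_(i < _) q`_i * 1 ^+ i = \sum_(i < size q) q`_i); last first.
  by apply: eq_bigr => i _; rewrite expr1n mulr1.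
rewrite [X in (_ <= X)%N]big_distrl /=; apply: leq_sum => i _.
by rewrite natrME natrXE leq_mul2l leq_pexp2l ?orbT// ltnW.
Qed.

Lemma not_approximable (Q : forall n, cut_problem R n) (c : R)
    (gamma : nat -> R) : 0 < c -> detects_bisections Q c ->
  gamma =o_\oo (fun n : nat => Num.sqrt (n%:R / ln n%:R) : R) ->
  ~ approximable (@nonneg_symmetric_submodular R) Q gamma.
Proof.
move=> c0 HQ /eqoP hgamma [A [q [p [pcvg qA pA]]]].
(* [D] exceeds by one the exponent in [horner_nat_le], so the union bound is O(1/n). The constant
   [s] satisfies sqrt(n / ln n) beta = n s for the [beta] below. *)
pose D := (size q).+1; pose s : R := Num.sqrt (4 * D%:R).
have D0 : 0 < D%:R :> R by rewrite ltr0n.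
have s0 : 0 < s by rewrite sqrtr_gt0 mulr_gt0.
have [|N1 _ HN1] := hgamma (c / (2 * s)); first by rewrite divr_gt0 ?mulr_gt0.
(* With p >= 3/4 the joint success bound 2p - 1 is at least 1/2, which will force n <= 4 q(1); [m]
   is chosen to violate this. *)
have [|N2 _ HN2] := cvgr_ge _ pcvg (3 / 4); first lra.
pose m := (N1 + N2 + 4 * q.[1] + 1)%N; pose n := (m + m)%N.
have m0 : (0 < m)%N by rewrite /m; lia.
have mR : 0 < m%:R :> R by rewrite ltr0n.
have n1 : 1 < n%:R :> R by rewrite ltr1n /n /m; lia.
have nE : n%:R = 2 * m%:R :> R by rewrite natrD; ring.
have gn := HN1 n ltac:(rewrite /= /n /m; lia).
have pn := HN2 n ltac:(rewrite /= /n /m; lia).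
have n0 : 0 < n%:R :> R by lra.
have L0 : 0 < ln n%:R :> R by exact: ln_gt0.
(* Chosen so that the tail exp(- beta^2 / (8m)) equals n^-D. *)
pose beta : R := Num.sqrt (8 * m%:R * (D%:R * ln n%:R)).
have b0 : 0 <= beta by exact: sqrtr_ge0.
have b2 : beta ^+ 2 / (8 * m%:R) = D%:R * ln n%:R.
  rewrite sqr_sqrtr; last by rewrite !mulr_ge0// ltW.
  by field; rewrite gt_eqF.
have gb : gamma n * beta < c * (m + m)%:R.
  have step : gamma n * beta <= c / (2 * s) * (n%:R * s).
    apply: le_trans (_ : `|gamma n| * beta <= _).
      by rewrite ler_wpM2r// ler_norm.
    apply: le_trans (ler_wpM2r b0 gn) _.
    rewrite ger0_norm ?sqrtr_ge0// -[leLHS]mulrA; apply: ler_wpM2l.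
      by rewrite divr_ge0// ?mulr_ge0// ltW.
    rewrite /beta -sqrtrM; last by rewrite divr_ge0// ltW.
    rewrite (_ : _ * _ = n%:R ^+ 2 * (4 * D%:R)); last first.
      by rewrite nE; field; rewrite -nE gt_eqF.
    by rewrite sqrtrM ?sqr_ge0// sqrtr_sqr ger0_norm// ltW.
  apply: le_lt_trans step _; rewrite -/n.
  have -> : c / (2 * s) * (n%:R * s) = c * n%:R / 2.
    by field; rewrite gt_eqF.
  by have := mulr_gt0 c0 n0; lra.
(* Since [n] is even, a bisection exists and the success requirement applies. *)
have bis : exists S, feasible (Q n) S.
  exists (half_of [ffun=> true]); apply: (bisection_feasible HQ) => //.
  exact: card_half.
have := success_probability_le (A := A n) (p := p n) (q := q.[n]) HQ m0 b0 gb.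
have /[swap] /[apply] : forall w : seed (A n),
    (query_count (tree w) (@blind_cut R m) <= q.[n])%N.
  by move=> w; apply: qA; exact: blind_cut_nss.
move=> /(_ (fun f nssf => pA n f nssf bis)).
rewrite b2 expRN expRM_natl lnK ?posrE// ler_pdivlMr ?exprn_gt0//.
have qn : q.[n]%:R <= q.[1]%:R * n%:R ^+ size q :> R.
  by rewrite -natrX -natrM ler_nat horner_nat_le// /n /m; lia.
have cn : 4 * q.[1]%:R < n%:R :> R.
  by rewrite -natrM ltr_nat /n /m; lia.
rewrite /D exprS.
have X0 : 0 < n%:R ^+ size q :> R by exact: exprn_gt0.
move: pn => /= pn.
have h1 : 1 / 2 * (n%:R * n%:R ^+ size q)
    <= (2 * p n - 1) * (n%:R * n%:R ^+ size q).
  by rewrite ler_pM2r ?mulr_gt0//; lra.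
have h2 : 4 * q.[1]%:R * n%:R ^+ size q < n%:R * n%:R ^+ size q :> R.
  by rewrite ltr_pM2r.
lra.
Qed.

End Hardness.

(** * Transfer between classes of functions and conclusion *)

Lemma approximable_subclass (R : realType)
    (cls cls' : forall n, ({set 'I_n} -> R) -> Prop) Q (gamma : nat -> R) :
  (forall n f, cls' n f -> cls n f) ->
  approximable cls Q gamma -> approximable cls' Q gamma.
Proof.
move=> sub [A [q [p [pcvg qA pA]]]]; exists A, q, p; split=> // n f *.
  by apply: qA; exact: sub.
by apply: pA => //; exact: sub.
Qed.

Theorem theorem6 (R : realType) (gamma : nat -> R)
  (hgamma : gamma =o_\oo (fun n : nat => Num.sqrt (n%:R / ln n%:R) : R)) :
  [/\ ~ approximable (@nonneg_submodular R) (@sparsest_cut R) gamma,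
      forall b : R, 0 < b -> b <= 1 / 2 ->
        ~ approximable (@nonneg_submodular R)
            (fun n => balanced_cut n b) gamma,
      ~ approximable (@nonneg_symmetric_submodular R) (@sparsest_cut R) gamma
    & forall b : R, 0 < b -> b <= 1 / 2 ->
        ~ approximable (@nonneg_symmetric_submodular R)
            (fun n => balanced_cut n b) gamma].
Proof.
have sub n (f : {set 'I_n} -> R) :
    nonneg_symmetric_submodular f -> nonneg_submodular f by case.
have sparse : ~ approximable (@nonneg_symmetric_submodular R)
    (@sparsest_cut R) gamma.
  by apply: (not_approximable _ (sparsest_detects R)) => //; lra.
have bal b : 0 < b -> b <= 1 / 2 -> ~ approximable
    (@nonneg_symmetric_submodular R) (fun n => balanced_cut n b) gamma.
  by move=> b0 b1; exact: (not_approximable b0 (balanced_detects b0 b1)).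
split=> //.
  by move=> /(approximable_subclass sub).
by move=> b b0 b1 /(approximable_subclass sub); exact: bal.
Qed.
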